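(* Let $D$ be a set with $|D|\geq 3$, and let $a,c,0_{\vdash}\in D$ be pairwise distinct. Let $(D,\dashv)$ be a null semigroup with zero $0_{\dashv}$, where $0_{\dashv}\neq a$, and define the binary operation $\vdash$ on $D$ by $$ x\vdash y= \begin{cases} c,&\text{if }x=y=a\\ 0_{\vdash},&\text{otherwise}. \end{cases} $$ Then $(D,\dashv,\vdash)$ is a $2$-dinilpotent commutative $g$-dimonoid. Moreover, it is a dimonoid if and only if $0_{\dashv}=0_{\vdash}$.
   Context: A null semigroup with zero $0$ is a semigroup in which $xy=0$ for all $x,y$. A $g$-dimonoid is a set $D$ with two associative binary operations $\dashv,\vdash$ satisfying, for all $x,y,z\in D$, $(D_1)$ $(x\dashv y)\dashv z=x\dashv(y\vdash z)$ and $(D_3)$ $(x\dashv y)\vdash z=x\vdash(y\vdash z)$. A dimonoid is a $g$-dimonoid which also satisfies $(D_2)$ $(x\vdash y)\dashv z=x\vdash(y\dashv z)$ for all $x,y,z\in D$. A $g$-dimonoid is commutative if both semigroups $(D,\dashv)$ and $(D,\vdash)$ are commutative. A semigroup $S$ with zero $0$ is nilpotent if $S^{n+1}=\{0\}$ for some $n\in\mathbb N$; the least such $n$ is its nilpotency index; $S$ is $n$-nilpotent if it is nilpotent of nilpotency index $\le n$ (so $2$-nilpotent means that all products of three elements equal the zero). A $g$-dimonoid $(D,\dashv,\vdash)$ is $n$-dinilpotent if both semigroups $(D,\dashv)$ and $(D,\vdash)$ are $n$-nilpotent; each of the two semigroups has its own zero, and these two zeros are allowed to be distinct. *)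

(* Defs.v *)
From mathcomp Require Import all_boot boolp classical_sets.

Set Implicit Arguments.
Unset Strict Implicit.
Unset Printing Implicit Defensive.

Local Open Scope classical_set_scope.

Section Semigroups.
Context {S : Type}.
Implicit Types (op : S -> S -> S) (z : S) (n : nat).

Definition semigroup_with_zero op z : Prop :=
  [/\ associative op, left_zero z op & right_zero z op].

Definition null_semigroup op z : Prop :=
  semigroup_with_zero op z /\ (forall x y, op x y = z).

(* [power_succ op n] is S^{n+1}, the set of all products of n+1 elements. *)
Definition power_succ op n : set S :=
  iter n (fun A : set S => [set op x y | x in A & y in [set: S]]) [set: S].

Definition nilpotency_bound op z n : Prop :=
  (0 < n)%N /\ power_succ op n = [set z].

Definition nilpotency_index op z n : Prop :=
  nilpotency_bound op z n /\
  (forall m, nilpotency_bound op z m -> (n <= m)%N).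

(* n-nilpotent means of nilpotency index at most n; the zero is existentially
   quantified, hence may differ between two semigroups on the same carrier. *)
Definition nilpotent n op : Prop :=
  exists z, semigroup_with_zero op z /\
    exists2 m, nilpotency_index op z m & (m <= n)%N.

End Semigroups.

(* In what follows [l] stands for the operation \dashv and [r] for \vdash. *)
Section Dimonoids.
Context {D : Type}.
Implicit Types (l r : D -> D -> D) (n : nat).

Definition g_dimonoid l r : Prop :=
  [/\ associative l,
      associative r,
      (forall x y z, l (l x y) z = l x (r y z)) &
      (forall x y z, r (l x y) z = r x (r y z))].

Definition dimonoid l r : Prop :=
  g_dimonoid l r /\ (forall x y z, l (r x y) z = r x (l y z)).

Definition commutative_g_dimonoid l r : Prop :=
  [/\ g_dimonoid l r, commutative l & commutative r].

Definition dinilpotent n l r : Prop :=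
  [/\ g_dimonoid l r, nilpotent n l & nilpotent n r].

Definition vdash (a c z x y : D) : D :=
  if `[< x = a /\ y = a >] then c else z.

End Dimonoids.

(* Main.v *)
Require Import Defs.
From mathcomp Require Import all_boot boolp classical_sets.

(** The element [a] is the only one whose square under [vdash] is not the zero,
    and [a] is itself not a product: it differs from [c], from the zero of
    [vdash] and from the zero of [dashv].  Hence a [vdash]-product with a factor
    that is a product of either operation always equals the zero of [vdash]
    ([vdash_neq_l], [vdash_neq_r]).  Dually, every [dashv]-product equals the
    zero of [dashv].  So each axiom on triple products compares two constants:
    in associativity, [(D_1)] and [(D_3)] both sides are the same zero, whereas
    [(D_2)] has the zero of [dashv] on the left and that of [vdash] on the
    right.  The same remark makes triple products vanish in both semigroups;
    [nilpotent_of_bound] turns this into the bound on the nilpotency index. *)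

Set Implicit Arguments.
Unset Strict Implicit.
Unset Printing Implicit Defensive.

(** The nilpotency index is the least exponent at which the powers collapse, so
    any exponent at which they do bounds it from above. *)
Lemma nilpotent_of_bound (S : Type) (op : S -> S -> S) (z : S) (m n : nat) :
  semigroup_with_zero op z -> nilpotency_bound op z m -> m <= n ->
  nilpotent n op.
Proof.
move=> op_zero bound_m le_mn; exists z; split=> //.
have ex_bound : exists k, `[< nilpotency_bound op z k >].
  by exists m; apply/asboolP.
case: (ex_minnP ex_bound) => k /asboolP bound_k min_k.
exists k; last by apply: leq_trans le_mn; apply: min_k; apply/asboolP.
by split=> // j bound_j; apply: min_k; apply/asboolP.
Qed.

(** A constant value of all products is itself attained, for instance by the
    product of [z] with itself, so the set of products is exactly
    the singleton of [z]. *)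
Lemma nilpotency_bound1 (S : Type) (op : S -> S -> S) (z : S) :
  (forall x y, op x y = z) -> nilpotency_bound op z 1.
Proof.
move=> op_z; split=> //; apply/seteqP; split=> [_ [x _ [y _ <-]]|_ ->] /=.
  exact: op_z.
by exists z => //; exists z.
Qed.

Lemma nilpotency_bound2 (S : Type) (op : S -> S -> S) (z : S) :
  (forall x y t, op (op x y) t = z) -> nilpotency_bound op z 2.
Proof.
move=> op_z; split=> //; apply/seteqP.
split=> [_ [_ [x _ [y _ <-]] [t _ <-]]|_ ->] /=.
  exact: op_z.
by exists (op z z); [exists z => //; exists z | exists z].
Qed.

Section Vdash.
Context {D : Type} (a c z : D).

Lemma vdash_neq_l (x y : D) : x <> a -> vdash a c z x y = z.
Proof. by move=> x_neq_a; rewrite /vdash; case: asboolP => // -[]. Qed.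

Lemma vdashC : commutative (vdash a c z).
Proof. by move=> x y; rewrite /vdash andC. Qed.

Lemma vdash_neq_r (x y : D) : y <> a -> vdash a c z x y = z.
Proof. by rewrite vdashC; apply: vdash_neq_l. Qed.

Lemma vdash_value_neq (x y : D) : a <> c -> a <> z -> vdash a c z x y <> a.
Proof.
by move=> a_neq_c a_neq_z; rewrite /vdash; case: asboolP => _ /esym.
Qed.

End Vdash.

Theorem proposition3p5 (D : Type)
    (card_D : exists f : 'I_3 -> D, injective f)
    (a c zero_vdash : D)
    (a_neq_c : a <> c) (a_neq_zero_vdash : a <> zero_vdash)
    (c_neq_zero_vdash : c <> zero_vdash)
    (dashv : D -> D -> D) (zero_dashv : D)
    (dashv_null : null_semigroup dashv zero_dashv)
    (zero_dashv_neq_a : zero_dashv <> a) :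
  (dinilpotent 2 dashv (vdash a c zero_vdash) /\
   commutative_g_dimonoid dashv (vdash a c zero_vdash)) /\
  (dimonoid dashv (vdash a c zero_vdash) <-> zero_dashv = zero_vdash).
Proof.
have [dashv_zero dashvE] := dashv_null.
set r := vdash a c zero_vdash.
have r_l x y t : r (r x y) t = zero_vdash.
  by apply: vdash_neq_l; apply: vdash_value_neq.
have r_r x y t : r x (r y t) = zero_vdash.
  by apply: vdash_neq_r; apply: vdash_value_neq.
have r_zero : semigroup_with_zero r zero_vdash.
  split=> [x y t|x|x]; first by rewrite r_l r_r.
    by apply: vdash_neq_l => /esym.
  by apply: vdash_neq_r => /esym.
have gD : g_dimonoid dashv r.
  split=> [||x y t|x y t]; [by case: dashv_zero | by case: r_zero | |].
    by rewrite !dashvE.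
  by rewrite r_r dashvE [r zero_dashv _]vdash_neq_l.
split; first split.
- split=> //.
    exact: (nilpotent_of_bound dashv_zero (nilpotency_bound1 dashvE)).
  exact: (nilpotent_of_bound r_zero (nilpotency_bound2 r_l)).
- by split=> // [x y|]; [rewrite !dashvE | apply: vdashC].
- split=> [[_ /(_ a a a)]|eq_zero].
    by rewrite !dashvE [r _ _]vdash_neq_r.
  by split=> // x y t; rewrite !dashvE [r _ zero_dashv]vdash_neq_r.
Qed.
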